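(* Let $K$ be a non-archimedean ordered field with natural valuation $v$, whose valuation ring $R_v$ is the convex hull of $\mathbb{Q}$ in $K$, and let $\mathbf{P}_K := K^{>0}\setminus R_v$. Let $\mathcal{R}$ be the set of valuation rings of convex valuations $w$ of $K$ with $R_w\neq R_v$, ordered by inclusion, and let $\mathcal{R}^{\rm pr}\subseteq\mathcal{R}$ be the subset of principal ones. Let $\sim_\varphi$ be the equivalence relation on $\mathbf{P}_K$ given by $a\sim_\varphi a'$ iff there is $n\in\mathbb{N}_0$ with $a^{2^n}\ge a'$ and $a'^{2^n}\ge a$, and order $\mathbf{P}_K/\sim_\varphi$ by $[a]<[b]$ iff $a'<b'$ for all $a'\in[a]$, $b'\in[b]$. Then $\mathcal{R}$ is order isomorphic to the chain of non-empty initial segments of $\mathbf{P}_K/\sim_\varphi$ ordered by inclusion, and $\mathcal{R}^{\rm pr}$ is order isomorphic to the subchain of those initial segments which have a last element.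
   Context: A valuation $w$ on an ordered field $K$ is convex (compatible with the order) if $a\ge b>0$ implies $w(a)\le w(b)$; equivalently its valuation ring $R_w$ is convex. The convex valuation rings different from $R_v$ are exactly the convex subrings properly containing $R_v$. A convex valuation ring $R_w\neq R_v$ is principal (generated by $a\in\mathbf{P}_K$) if it is the smallest convex subring of $K$ containing $a$; $\mathcal{R}^{\rm pr}$ is the set of all principal $R_w\in\mathcal{R}$. The equivalence classes of $\sim_\varphi$ are convex, so the order on the quotient is well defined. *)

(* Defs.v *)
From mathcomp Require Import all_boot all_order all_algebra.
From mathcomp Require Import all_classical.

Set Implicit Arguments.
Unset Strict Implicit.
Unset Printing Implicit Defensive.

Import Order.TTheory GRing.Theory Num.Theory.
Local Open Scope classical_set_scope.
Local Open Scope ring_scope.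

(* [porderZmodType] requires neither totality nor translation invariance of the
   order. *)
Record orderedAbelianGroup := OrderedAbelianGroup {
  oag_sort :> porderZmodType;
  oag_le_total : total (<=%R : rel oag_sort);
  oag_lerD2l : forall x y z : oag_sort, x <= y -> z + x <= z + y
}.

(* Values lie in [option G], with [None] playing the role of infinity. *)
Definition val_le (G : orderedAbelianGroup) (x y : option G) : Prop :=
  match x, y with
  | _, None => True
  | None, Some _ => False
  | Some a, Some b => a <= b
  end.

Definition val_add (G : orderedAbelianGroup) (x y : option G) : option G :=
  match x, y with
  | Some a, Some b => Some (a + b)
  | _, _ => None
  end.

Record valuation (K : fieldType) := Valuation {
  value_group : orderedAbelianGroup;
  value :> K -> option value_group;
  value_eq_infty : forall x, value x = None <-> x = 0;
  valueM : forall x y, value (x * y) = val_add (value x) (value y);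
  (* w (x + y) >= min (w x) (w y) *)
  valueD : forall x y,
    val_le (value x) (value (x + y)) \/ val_le (value y) (value (x + y))
}.

Definition valuation_ring (K : fieldType) (w : valuation K) : set K :=
  [set x | val_le (Some 0) (w x)].

Definition convex_valuation (K : realFieldType) (w : valuation K) : Prop :=
  forall a b : K, 0 < b -> b <= a -> val_le (w a) (w b).

Definition rat_convex_hull (K : realFieldType) : set K :=
  [set x | exists p q : rat, ratr p <= x <= ratr q].

Definition natural_valuation (K : realFieldType) (v : valuation K) : Prop :=
  valuation_ring v = @rat_convex_hull K.

Definition order_convex (K : realFieldType) (S : set K) : Prop :=
  forall x y z, S x -> S z -> x <= y <= z -> S y.

Definition convex_subring (K : realFieldType) (S : set K) : Prop :=
  GRing.subring_closed [in S] /\ order_convex S.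

Section NaturalValuation.
Context (K : realFieldType) (v : valuation K).

Definition PK : set K := [set a | 0 < a] `\` valuation_ring v.

Definition convex_valuation_rings : set (set K) :=
  [set R | R <> valuation_ring v /\
           exists2 w : valuation K, convex_valuation w & R = valuation_ring w].

Definition generated_by (R : set K) (a : K) : Prop :=
  [/\ convex_subring R, R a & forall S, convex_subring S -> S a -> R `<=` S].

Definition principal_valuation_rings : set (set K) :=
  [set R | convex_valuation_rings R /\ exists2 a, PK a & generated_by R a].

Definition sim_phi (a b : K) : Prop :=
  exists n : nat, b <= a ^+ (2 ^ n) /\ a <= b ^+ (2 ^ n).

Definition phi_class (a : K) : set K := [set b | PK b /\ sim_phi a b].

(* The quotient PK / sim_phi, realised as the set of its classes. *)
Definition phi_quotient : set (set K) := phi_class @` PK.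

Definition phi_lt (A B : set K) : Prop := forall a b, A a -> B b -> a < b.

Definition phi_initial_segment (I : set (set K)) : Prop :=
  I `<=` phi_quotient /\
  forall A B, phi_quotient A -> I B -> phi_lt A B -> I A.

Definition nonempty_initial_segments : set (set (set K)) :=
  [set I | phi_initial_segment I /\ I !=set0].

Definition has_last (I : set (set K)) : Prop :=
  exists2 A, I A & forall B, I B -> B = A \/ phi_lt B A.

Definition initial_segments_with_last : set (set (set K)) :=
  [set I | nonempty_initial_segments I /\ has_last I].

End NaturalValuation.

(* Isomorphism of two families of sets, both ordered by inclusion. *)
Definition inclusion_isomorphic (S T : Type)
    (A : set (set S)) (B : set (set T)) : Prop :=
  exists2 f : set S -> set T, set_bij A B f &
    forall X Y, A X -> A Y -> (X `<=` Y <-> f X `<=` f Y).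

(* Main.v *)
(** The rings in question are the convex subrings of [K] meeting [PK], because
    a convex subring [S] contains [x] or [x^-1] for every [x], hence is the
    valuation ring of the quotient map onto [K^* / S^*]. Such a ring [R] is
    closed under [sim_phi], since [a ~ b] forces [b <= a ^+ (2 ^ n)], and it is
    determined by the classes it meets, which form an initial segment [I]. It
    is recovered from [I] as the set of all [x] with [|x| <= a] for some [a] of
    class in [I]: sums and products of two elements bounded by [a] are bounded
    by [a ^+ 2], which lies in the class of [a]. The smallest convex subring
    containing [a] consists of the [x] with [|x| <= a ^+ (2 ^ n)] for some [n],
    so it corresponds to the segment with last element the class of [a]. *)
Require Import Defs.
From HB Require Import structures.
From mathcomp Require Import all_boot all_order all_algebra.
From mathcomp Require Import all_classical.
From mathcomp Require Import lra.

Set Implicit Arguments.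
Unset Strict Implicit.
Unset Printing Implicit Defensive.

Import Order.TTheory GRing.Theory Num.Theory.
Local Open Scope classical_set_scope.
Local Open Scope quotient_scope.
Local Open Scope ring_scope.

(** * Closure properties of subrings given as predicates *)

Section SubringClosed.
Context (K : pzRingType) (S : set K) (hS : GRing.subring_closed [in S]).

Lemma subring1 : S 1.
Proof. by case: hS => h _ _; rewrite inE in h. Qed.

Lemma subringB x y : S x -> S y -> S (x - y).
Proof.
by case: hS => _ h _ Sx Sy; have := h x y; rewrite !inE => /(_ Sx Sy).
Qed.

Lemma subringM x y : S x -> S y -> S (x * y).
Proof.
by case: hS => _ _ h Sx Sy; have := h x y; rewrite !inE => /(_ Sx Sy).
Qed.

Lemma subring0 : S 0.
Proof. by rewrite -(subrr 1); apply: subringB; exact: subring1. Qed.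

Lemma subringN x : S x -> S (- x).
Proof. by move=> Sx; rewrite -sub0r; apply: subringB => //; exact: subring0. Qed.

Lemma subringD x y : S x -> S y -> S (x + y).
Proof.
by move=> Sx Sy; rewrite -[y]opprK; apply: subringB => //; exact: subringN.
Qed.

Lemma subringX x n : S x -> S (x ^+ n).
Proof.
move=> Sx; elim: n => [|n IH]; first exact: subring1.
by rewrite exprS; exact: subringM.
Qed.

Lemma subring_nat n : S n%:R.
Proof.
elim: n => [|n IH]; first exact: subring0.
by rewrite -addn1 natrD; apply: subringD => //; exact: subring1.
Qed.

End SubringClosed.

(** * The valuation attached to a valuation subring *)

Record valuation_subring (K : fieldType) := ValuationSubring {
  (* Not typed [set K], which would not give a coercion to functions. *)
  vs_set :> K -> Prop;
  vs_subring : GRing.subring_closed [in (vs_set : set K)];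
  vs_total : forall x, vs_set x \/ vs_set x^-1
}.

Section ValueGroup.
Context (K : fieldType) (S : valuation_subring K).

Let S1 : S 1 := subring1 (vs_subring S).
Let SM : forall x y, S x -> S y -> S (x * y) := subringM (vs_subring S).

Let U := {x : K | x != 0}.
Let vr (u : U) : val u != 0 := valP u.

(** The quotient of [u] by [w] is a unit of [S], so the classes form [K^* / S^*], which is to be the
    value group written additively. *)
Definition same_value (u w : U) : bool :=
  `[< S (val u / val w) /\ S (val w / val u) >].

Lemma quotient_mem_trans (x y z : K) : y != 0 -> S (x / y) -> S (y / z) -> S (x / z).
Proof. by move=> y0 /SM h /h; rewrite mulrA divfK. Qed.

Lemma same_value_refl : reflexive same_value.
Proof. by move=> u; apply/asboolP; rewrite divff. Qed.

Lemma same_value_sym : symmetric same_value.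
Proof. by move=> u w; apply/asboolP/asboolP => -[]. Qed.

Lemma same_value_trans : transitive same_value.
Proof.
move=> y x z /asboolP[xy yx] /asboolP[yz zy]; apply/asboolP.
by split; apply: (quotient_mem_trans (vr y)).
Qed.

Definition same_value_equiv :=
  EquivRel same_value same_value_refl same_value_sym same_value_trans.

Definition value_grp : Type := {eq_quot same_value_equiv}.
HB.instance Definition _ := Choice.on value_grp.
HB.instance Definition _ := EqQuotient.on value_grp.


Definition class_of (u : U) : value_grp := \pi_value_grp u.

Lemma class_ofP u w :
  class_of u = class_of w <-> S (val u / val w) /\ S (val w / val u).
Proof.
by split=> [/eqquotP/asboolP//|h]; apply/eqquotP/asboolP.
Qed.

Lemma class_of_surj g : exists u, g = class_of u.
Proof. by exists (repr g); rewrite /class_of reprK. Qed.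

Lemma repr_class_of u :
  S (val u / val (repr (class_of u))) /\ S (val (repr (class_of u)) / val u).
Proof. by apply/class_ofP; rewrite [RHS]reprK. Qed.

Definition mulU (u w : U) : U :=
  exist _ (val u * val w) (mulf_neq0 (vr u) (vr w)).
Definition invU (u : U) : U := exist _ (val u)^-1 (invr_neq0 (vr u)).
Definition oneU : U := exist _ 1 (oner_neq0 K).

Definition vadd (g h : value_grp) := class_of (mulU (repr g) (repr h)).
Definition vopp (g : value_grp) := class_of (invU (repr g)).
(** Divisibility with respect to [S]: values grow along multiplication by elements of [S]. *)
Definition vle (g h : value_grp) : bool := `[< S (val (repr h) / val (repr g)) >].

(** Independence of the representatives chosen by [repr]: replacing factors by unit multiples
    changes the product by a unit. *)
Lemma vaddE u w : vadd (class_of u) (class_of w) = class_of (mulU u w).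
Proof.
have [u1 u2] := repr_class_of u; have [w1 w2] := repr_class_of w.
by apply/class_ofP; rewrite /= !invfM; split; rewrite mulrACA; exact: SM.
Qed.

Lemma voppE u : vopp (class_of u) = class_of (invU u).
Proof.
have [u1 u2] := repr_class_of u.
by apply/class_ofP; rewrite /= !invrK ![_^-1 * _]mulrC.
Qed.

Lemma vleE u w : vle (class_of u) (class_of w) <-> S (val w / val u).
Proof.
have [u1 u2] := repr_class_of u; have [w1 w2] := repr_class_of w.
rewrite -(rwP (asboolP _)); split=> h.
  apply: (quotient_mem_trans (vr (repr (class_of u)))) => //.
  exact: (quotient_mem_trans (vr (repr (class_of w)))).
by apply: (quotient_mem_trans (vr u)) => //; exact: (quotient_mem_trans (vr w)).
Qed.

Lemma class_of_eq u w : val u = val w -> class_of u = class_of w.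
Proof. by move=> /val_inj ->. Qed.

Lemma vaddA : associative vadd.
Proof.
move=> g h k; have [u ->] := class_of_surj g; have [w ->] := class_of_surj h.
have [t ->] := class_of_surj k; rewrite !vaddE.
by apply: class_of_eq; rewrite /= mulrA.
Qed.

Lemma vaddC : commutative vadd.
Proof. by move=> g h; apply: class_of_eq; rewrite /= mulrC. Qed.

Lemma vadd0 : left_id (class_of oneU) vadd.
Proof.
move=> g; have [u ->] := class_of_surj g; rewrite vaddE.
by apply: class_of_eq; rewrite /= mul1r.
Qed.

Lemma vaddN : left_inverse (class_of oneU) vopp vadd.
Proof.
move=> g; have [u ->] := class_of_surj g; rewrite voppE vaddE.
by apply: class_of_eq; rewrite /= mulVf// vr.
Qed.

Lemma vle_refl : reflexive vle.
Proof.
by move=> g; have [u ->] := class_of_surj g; apply/vleE; rewrite divff// vr.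
Qed.

Lemma vle_anti : antisymmetric vle.
Proof.
move=> g h; have [u ->] := class_of_surj g; have [w ->] := class_of_surj h.
by case/andP=> /vleE wu /vleE uw; apply/class_ofP.
Qed.

Lemma vle_trans : transitive vle.
Proof.
move=> h g k; have [u ->] := class_of_surj g; have [w ->] := class_of_surj h.
have [t ->] := class_of_surj k => /vleE wu /vleE tw; apply/vleE.
exact: (quotient_mem_trans (vr w)).
Qed.

HB.instance Definition _ :=
  GRing.isZmodule.Build value_grp vaddA vaddC vadd0 vaddN.
HB.instance Definition _ :=
  Order.Le_isPOrder.Build ring_display value_grp vle_refl vle_anti vle_trans.

Lemma vle_total : total (<=%R : rel value_grp).
Proof.
move=> g h; have [u ->] := class_of_surj g; have [w ->] := class_of_surj h.
have [H|] := vs_total S (val w / val u); first by apply/orP; left; apply/vleE.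
by rewrite invf_div => H; apply/orP; right; apply/vleE.
Qed.

Lemma vle_add2l (x y z : value_grp) : x <= y -> z + x <= z + y.
Proof.
have [u ->] := class_of_surj x; have [w ->] := class_of_surj y.
have [t ->] := class_of_surj z => /vleE H.
by rewrite /GRing.add /= !vaddE; apply/vleE; rewrite /= -mulf_div divff ?mul1r ?vr.
Qed.

Definition value_oag : orderedAbelianGroup :=
  OrderedAbelianGroup vle_total vle_add2l.

Definition vs_value (x : K) : option value_oag :=
  if insub x is Some u then Some (class_of u : value_oag) else None.

Lemma vs_valueP x : x = 0 /\ vs_value x = None \/
  exists2 u : U, val u = x & vs_value x = Some (class_of u : value_oag).
Proof.
rewrite /vs_value; case: insubP => [u ? <-|]; first by right; exists u.
by rewrite negbK => /eqP ->; left.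
Qed.

Lemma vs_value_eq_infty x : vs_value x = None <-> x = 0.
Proof.
have [[-> ->]|[u <- ->]] := vs_valueP x; first by [].
by split=> // u0; case/eqP: (vr u).
Qed.

Lemma vs_value0 : vs_value 0 = None.
Proof. exact/vs_value_eq_infty. Qed.

Lemma vs_value_val u : vs_value (val u) = Some (class_of u : value_oag).
Proof. by rewrite /vs_value valK. Qed.

Lemma vs_valueM x y : vs_value (x * y) = val_add (vs_value x) (vs_value y).
Proof.
have [[-> ->]|[u <- ->]] := vs_valueP x; first by rewrite mul0r vs_value0.
have [[-> ->]|[w <- ->]] := vs_valueP y; first by rewrite mulr0 vs_value0.
by rewrite -[_ * _]/(val (mulU u w)) vs_value_val /= /GRing.add /= vaddE.
Qed.

(** A multiplier [c] instead of the quotient [y / x] also covers the cases where [x] or [y] is zero,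
    that is, has infinite value. *)
Lemma vs_value_le x y :
  val_le (vs_value x) (vs_value y) <-> exists2 c, S c & y = c * x.
Proof.
have S0 : S 0 := subring0 (vs_subring S).
have [[-> ->]|[w <- ->]] := vs_valueP y.
  by split=> [_|]; [exists 0 => //; rewrite mul0r|case: (vs_value x)].
have [[-> ->]|[u <- ->]] := vs_valueP x.
  by split=> //= -[c _ w0]; case/eqP: (vr w); rewrite /= w0 mulr0.
split=> [/vleE H|[c Sc e]]; first by exists (val w / val u) => //; rewrite divfK ?vr.
by apply/vleE; rewrite e mulfK ?vr.
Qed.

Lemma vs_valueD x y :
  val_le (vs_value x) (vs_value (x + y)) \/ val_le (vs_value y) (vs_value (x + y)).
Proof.
have [->|x0] := eqVneq x 0.
  by right; apply/vs_value_le; exists 1; rewrite ?mul1r ?add0r.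
have [->|y0] := eqVneq y 0.
  by left; apply/vs_value_le; exists 1; rewrite ?mul1r ?addr0.
(* Factor out whichever summand divides the other: [x + y = (1 + y / x) * x], or symmetrically. *)
have [H|] := vs_total S (y / x); [left|rewrite invf_div => H; right];
  apply/vs_value_le.
  exists (1 + y / x); first exact: (subringD (vs_subring S)).
  by rewrite mulrDl mul1r divfK.
exists (x / y + 1); first exact: (subringD (vs_subring S)).
by rewrite mulrDl mul1r divfK.
Qed.

Definition vs_valuation : valuation K :=
  Valuation vs_value_eq_infty vs_valueM vs_valueD.

Lemma vs_valuation_ring : valuation_ring vs_valuation = S :> set K.
Proof.
(* Reading the zero of the group as the value of 1 turns nonnegativity into divisibility of [x] by
   1. *)
have e : Some (0 : value_oag) = vs_value 1 by rewrite -[1]/(val oneU) vs_value_val.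
apply/seteqP; split=> x; rewrite /valuation_ring /mkset e /= vs_value_le.
  by case=> c Sc ->; rewrite mulr1.
by move=> Sx; exists x; rewrite ?mulr1.
Qed.

End ValueGroup.

(** * Convex subrings are valuation rings of convex valuations *)

Section ConvexSubring.
Context (K : realFieldType) (S : set K) (hS : convex_subring S).

Lemma convex_subring_normr x : S `|x| <-> S x.
Proof.
by case: (ger0P x) => // _; split=> /(subringN hS.1); rewrite ?opprK.
Qed.

Lemma convex_subring_le x y : S y -> `|x| <= y -> S x.
Proof.
move=> Sy xy; apply/convex_subring_normr.
by apply: (hS.2 0 `|x| y) => //; [exact: subring0 hS.1|rewrite normr_ge0].
Qed.

(** One of [x] and [x^-1] has absolute value at most 1, and [S] contains the interval from -1 to
    1. *)
Lemma convex_subring_total x : S x \/ S x^-1.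
Proof.
have S1 := subring1 hS.1.
have [x1|x1] := leP `|x| 1; [left|right]; apply: (convex_subring_le S1) => //.
by rewrite normfV invf_le1 ?(ltW x1) ?(lt_trans _ x1).
Qed.

Lemma rat_convex_hull_sub : @rat_convex_hull K `<=` S.
Proof.
(* Each rational is bounded in absolute value by a natural number, which lies in [S]. *)
have Srat (p : rat) : S (ratr p).
  apply: (convex_subring_le (subring_nat hS.1 (Num.bound `|p|))).
  by rewrite -ratr_norm -(ratr_nat K) ler_rat ltW// archi_boundP.
by move=> x [p [q pq]]; apply: (hS.2 (ratr p) x (ratr q)).
Qed.

Lemma convex_subring_valuation :
  exists2 w : valuation K, convex_valuation w & S = valuation_ring w.
Proof.
pose V : valuation_subring K :=
  ValuationSubring (vs_set := S) hS.1 convex_subring_total.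
exists (vs_valuation V); last by rewrite vs_valuation_ring.
move=> a b b0 ba; apply/(vs_value_le V); exists (b / a).
  apply: (convex_subring_le (subring1 hS.1)).
  have a0 := lt_le_trans b0 ba.
  by rewrite gtr0_norm ?divr_gt0// ler_pdivrMr ?mul1r.
by rewrite divfK ?gt_eqF ?(lt_le_trans b0).
Qed.

End ConvexSubring.

(** * Conversely, convex valuations have convex valuation rings *)

Section OrderedAbelianGroup.
Context (G : orderedAbelianGroup).
Implicit Types x y z : G.

Lemma oag_addr_ge0 x y : 0 <= x -> 0 <= y -> 0 <= x + y.
Proof.
by move=> x0 /(oag_lerD2l x); rewrite addr0; exact: le_trans.
Qed.

(** Totality of the order excludes 2-torsion; this forces the value of -1 to be 0. *)
Lemma oag_double_eq0 x : x + x = 0 -> x = 0.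
Proof.
move=> xx0; apply/eqP; rewrite eq_le.
by case/orP: (oag_le_total 0 x) => x0; have := oag_lerD2l x x0;
  rewrite addr0 xx0 x0 ?andbT.
Qed.

Lemma val_le_trans (x y z : option G) : val_le x y -> val_le y z -> val_le x z.
Proof. by case: x y z => [x|] [y|] [z|] //=; exact: le_trans. Qed.

End OrderedAbelianGroup.

Section ValuationRing.
Context (K : fieldType) (w : valuation K).

Lemma value1 : w 1 = Some 0.
Proof.
case e: (w 1) => [g|]; last by case/eqP: (oner_neq0 K); apply/(value_eq_infty w).
have /= := valueM w 1 1; rewrite mulr1 e => -[].
by rewrite -[LHS]addr0 => /addrI <-.
Qed.

Lemma valueN x : w (- x) = w x.
Proof.
have w1 : w (-1) = Some 0.
  have := valueM w (-1) (-1); rewrite mulrNN mulr1 value1.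
  by case: (w (-1)) => //= g [] /esym/oag_double_eq0 ->.
by rewrite -mulN1r valueM w1; case: (w x) => //= g; rewrite add0r.
Qed.

Lemma valuation_ring_subring : GRing.subring_closed [in valuation_ring w].
Proof.
split=> [|x y|x y]; rewrite !inE /valuation_ring /mkset.
- by rewrite value1 /=.
- move=> x0 y0; rewrite -(valueN y) in y0.
  by have [] := valueD w x (- y); [exact: val_le_trans x0|exact: val_le_trans y0].
- rewrite valueM; case: (w x) (w y) => [g|] [h|] //=; exact: oag_addr_ge0.
Qed.

End ValuationRing.

Lemma convex_valuation_ring (K : realFieldType) (w : valuation K) :
  convex_valuation w -> convex_subring (valuation_ring w).
Proof.
move=> cw; split; first exact: valuation_ring_subring.
have norm_w x : w `|x| = w x by case: (ger0P x) => // _; rewrite valueN.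
move=> x y z Rx Rz /andP[xy yz].
(* Convexity of [w] compares values of positive elements only, so zero is set apart and the rest is
   argued on absolute values. *)
have [->|y0] := eqVneq y 0; first by apply: (subring0 (valuation_ring_subring w)).
rewrite /valuation_ring /mkset -norm_w.
have ny0 : 0 < `|y| by rewrite normr_gt0.
have [yx|] := leP `|y| `|x|.
  by apply: (@val_le_trans _ _ (w `|x|)); [rewrite norm_w|exact: cw].
move=> xy'; apply: (@val_le_trans _ _ (w `|z|)); first by rewrite norm_w.
apply: cw => //.
(* If [|x| < |y|] and [x <= y], then [y] is positive, so [y <= z] bounds [|y|] by [|z|]. *)
by move: xy' y0; case: (ger0P x); case: (ger0P y); case: (ger0P z); lra.
Qed.

(** * Convex rings and the elements of [PK] *)

Section NaturalValuation.
Context (K : realFieldType) (v : valuation K) (hv : natural_valuation v).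
Implicit Types (a b c x : K) (R S : set K).

Local Notation PK := (PK v).
Local Notation phi_class := (phi_class v).

(** Every convex subring contains the hull of the rationals, so it differs from it exactly when it
    has an element outside; the absolute value of that element is in [PK]. *)
Lemma convex_valuation_ringsP R :
  convex_valuation_rings v R <-> convex_subring R /\ (R `&` PK) !=set0.
Proof.
split=> [[neR [w cw eR]]|[cR [a [Ra [_ nva]]]]]; last first.
  by split; [move=> e; rewrite e in Ra|exact: convex_subring_valuation].
have cR : convex_subring R by rewrite eR; exact: convex_valuation_ring.
split=> //; apply/set0P/negP => /eqP R0.
apply: neR; apply/seteqP; split; last by rewrite hv; exact: rat_convex_hull_sub.
move=> x Rx; apply: contrapT => nvx.
have Nvx : ~ valuation_ring v (- x) by rewrite /valuation_ring /= valueN.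
have x0 : x != 0.
  apply: contra_notN nvx => /eqP ->; exact: (subring0 (valuation_ring_subring v)).
suff : (R `&` PK) `|x| by rewrite R0.
split; first exact/(convex_subring_normr cR).
by split; [rewrite /= normr_gt0|case: (ger0P x)].
Qed.

Lemma convex_subring_nPK S x : convex_subring S -> ~ PK `|x| -> S x.
Proof.
move=> cS; have [->|x0] := eqVneq x 0; first by move=> _; exact: subring0 cS.1.
move=> nP; apply/(convex_subring_normr cS)/(rat_convex_hull_sub cS).
by rewrite -hv; apply: contrapT => nv; apply: nP; split; rewrite /= ?normr_gt0.
Qed.

(** The bound 2 is what makes [a + a <= a ^+ 2], so that squaring absorbs sums as well as
    products. *)
Lemma PK_gt2 a : PK a -> 2 < a.
Proof.
case=> /= a0; rewrite hv ltNge => nva; apply/negP => a2; apply: nva.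
by exists 0, 2; rewrite rmorph0 ratr_nat (ltW a0).
Qed.

Lemma PK_le a b : PK a -> a <= b -> PK b.
Proof.
move=> [/= a0 nva] ab; split; first exact: lt_le_trans ab.
move: nva; rewrite hv => nva [p [q /andP[_ bq]]]; apply: nva.
by exists 0, q; rewrite rmorph0 (ltW a0) (le_trans ab).
Qed.

Lemma PK_pow_le a n m : PK a -> (n <= m)%N -> a ^+ n <= a ^+ m.
Proof. by move=> /PK_gt2 a2 nm; rewrite ler_eXn2l//; lra. Qed.

Lemma PK_le_pow a n : PK a -> a <= a ^+ (2 ^ n).
Proof. by move=> Pa; rewrite -[leLHS]expr1 PK_pow_le ?expn_gt0. Qed.

Lemma pow_bound_trans a b c n m : PK b -> c <= b ^+ (2 ^ m) -> b <= a ^+ (2 ^ n) ->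
  c <= a ^+ (2 ^ (n + m)).
Proof.
move=> [/= b0 _] cb ba; apply: (le_trans cb).
(* Iterated powers multiply their exponents, hence [n] and [m] add. *)
by rewrite expnD exprM lerXn2r ?nnegrE// ltW// (lt_le_trans b0).
Qed.

Lemma pow_bound_leq a b n m : PK a -> (n <= m)%N -> b <= a ^+ (2 ^ n) ->
  b <= a ^+ (2 ^ m).
Proof. by move=> Pa nm /le_trans; apply; rewrite PK_pow_le// leq_exp2l. Qed.

(** * Classes of [sim_phi] and their order *)

Lemma sim_phiP a b : PK a -> PK b ->
  sim_phi a b <-> (exists n, b <= a ^+ (2 ^ n)) /\ (exists n, a <= b ^+ (2 ^ n)).
Proof.
move=> Pa Pb; split=> [[n [ba ab]]|[[n ba] [m ab]]]; first by split; exists n.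
exists (maxn n m); split; [move: ba|move: ab]; apply: pow_bound_leq => //.
  exact: leq_maxl.
exact: leq_maxr.
Qed.

Lemma sim_phi_sym a b : sim_phi a b -> sim_phi b a.
Proof. by case=> n [ba ab]; exists n. Qed.

Lemma sim_phi_trans a b c : PK b -> sim_phi a b -> sim_phi b c -> sim_phi a c.
Proof.
move=> Pb [n [ba ab]] [m [cb bc]]; exists (n + m)%N; split.
  exact: pow_bound_trans cb ba.
by rewrite addnC; exact: pow_bound_trans ab bc.
Qed.

Lemma phi_class_refl a : PK a -> phi_class a a.
Proof. by move=> Pa; split=> //; exists 0%N; rewrite expn0 expr1. Qed.

Lemma phi_class_eq a b : PK a -> PK b -> sim_phi a b -> phi_class a = phi_class b.
Proof.
move=> Pa Pb ab; apply/seteqP; split=> c [Pc h]; split=> //.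
  exact: (sim_phi_trans Pa) (sim_phi_sym ab) h.
exact: (sim_phi_trans Pb) ab h.
Qed.

Lemma phi_class_inj a b : PK b -> phi_class a = phi_class b -> sim_phi a b.
Proof. by move=> /phi_class_refl + e; rewrite -e => -[]. Qed.

(** If the classes are not strictly ordered, some [b' <= a'] in them give [b <= b' ^+ (2 ^ m)] and
    [b' <= a' <= a ^+ (2 ^ n)], and the bounds compose. *)
Lemma phi_ltPn a b : PK a -> PK b ->
  phi_lt (phi_class a) (phi_class b) \/ exists n, b <= a ^+ (2 ^ n).
Proof.
move=> Pa Pb; have [|nba] := pselect (exists n, b <= a ^+ (2 ^ n)); first by right.
left=> a' b' [Pa' [n [a'a _]]] [Pb' [m [_ bb']]].
rewrite ltNge; apply/negP => b'a'; apply: nba; exists (n + m)%N.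
exact: (pow_bound_trans Pb' bb' (le_trans b'a' a'a)).
Qed.

Lemma phi_class_le a b : PK a -> PK b -> a <= b ->
  phi_class a = phi_class b \/ phi_lt (phi_class a) (phi_class b).
Proof.
move=> Pa Pb ab; have [|h] := phi_ltPn Pa Pb; [by right|left].
apply: phi_class_eq => //; apply/sim_phiP => //; split=> //.
by exists 0%N; rewrite expn0 expr1.
Qed.

Lemma phi_class_sqr a : PK a -> PK (a ^+ 2) /\ phi_class (a ^+ 2) = phi_class a.
Proof.
move=> Pa; have aa2 := @PK_le_pow a 1 Pa; have Pa2 := PK_le Pa aa2.
split=> //; apply/esym/phi_class_eq => //; exists 1%N; split=> //.
exact: (le_trans aa2 (@PK_le_pow _ 1 Pa2)).
Qed.

(** * The correspondence between convex rings and initial segments *)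

Definition segment_of_ring R : set (set K) := phi_class @` (R `&` PK).

Definition ring_of_segment (I : set (set K)) : set K :=
  [set x | exists2 a, PK a & I (phi_class a) /\ `|x| <= a].

(** Membership does not depend on the representative: if [b] in [R] has the class of [a], then [a]
    is bounded by a power of [b]. *)
Lemma segment_of_ringP R a : convex_subring R -> PK a ->
  segment_of_ring R (phi_class a) <-> R a.
Proof.
move=> cR Pa; split=> [[b [Rb Pb] /(phi_class_inj Pa)[n [ab _]]]|Ra]; last by exists a.
apply: (convex_subring_le cR (subringX cR.1 (2 ^ n) Rb)).
by rewrite gtr0_norm//; case: Pa.
Qed.

Lemma segment_of_ring_initial R : convex_valuation_rings v R ->
  nonempty_initial_segments v (segment_of_ring R).
Proof.
move=> /convex_valuation_ringsP[cR [a [Ra Pa]]]; split; last first.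
  by exists (phi_class a); apply/segment_of_ringP.
split=> [_ [b [_ Pb] <-]|_ _ [b Pb <-] [c [Rc Pc] <-] bc]; first by exists b.
apply/segment_of_ringP => //; apply: (convex_subring_le cR Rc).
rewrite gtr0_norm; last by case: Pb.
by apply: ltW; apply: bc; exact: phi_class_refl.
Qed.

(** Only elements with absolute value in [PK] matter, as all others lie in every convex subring.
    Both monotonicity and injectivity of the correspondence follow. *)
Lemma segment_of_ring_sub R S : convex_subring R -> convex_subring S ->
  segment_of_ring R `<=` segment_of_ring S <-> R `<=` S.
Proof.
move=> cR cS; split=> [sub x Rx|RS _ [a [Ra Pa] <-]]; last first.
  by apply/segment_of_ringP => //; exact: RS.
have [Px|] := pselect (PK `|x|); last exact: convex_subring_nPK.
apply/(convex_subring_normr cS)/segment_of_ringP => //; apply: sub.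
by apply/segment_of_ringP => //; exact/(convex_subring_normr cR).
Qed.

Lemma ring_of_segment_convex (I : set (set K)) : nonempty_initial_segments v I ->
  convex_subring (ring_of_segment I).
Proof.
move=> [[IQ _] [A IA]].
have [a0 Pa0 eA] := IQ _ IA; rewrite -eA in IA.
(* The larger of two bounds serves both elements, and its class is still in [I]. *)
have bound x y : ring_of_segment I x -> ring_of_segment I y ->
    exists2 a, PK a & [/\ I (phi_class a), `|x| <= a & `|y| <= a].
  move=> [a Pa [Ia xa]] [b Pb [Ib yb]].
  have [ab|/ltW ba] := leP a b; [exists b|exists a] => //; split=> //.
    exact: le_trans ab.
  exact: le_trans ba.
split; first split=> [|x y|x y]; rewrite ?inE.
- by exists a0 => //; split=> //; rewrite normr1; have := PK_gt2 Pa0; lra.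
- move=> Rx /(bound _ _ Rx)[a Pa [Ia xa ya]].
  have [Pa2 ea2] := phi_class_sqr Pa; exists (a ^+ 2); rewrite ?ea2//; split=> //.
  (* [|x - y| <= a + a <= a ^+ 2], using [2 < a]. *)
  have := ler_normB x y; have := PK_gt2 Pa; nra.
- move=> Rx /(bound _ _ Rx)[a Pa [Ia xa ya]].
  have [Pa2 ea2] := phi_class_sqr Pa; exists (a ^+ 2); rewrite ?ea2//; split=> //.
  by rewrite normrM expr2 ler_pM.
- move=> x y z Rx /(bound _ _ Rx)[a Pa [Ia xa za]] /andP[xy yz].
  by exists a => //; split=> //; move: xa za; rewrite !ler_norml; lra.
Qed.

Lemma ring_of_segmentK (I : set (set K)) : nonempty_initial_segments v I ->
  segment_of_ring (ring_of_segment I) = I.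
Proof.
move=> [[IQ Iinit] _]; apply/seteqP; split=> [_ [c [[a Pa [Ia ca]] Pc] <-]|A IA].
  rewrite gtr0_norm in ca; last by case: Pc.
  (* The class of an element below [a] is that of [a] or strictly smaller, so the initial segment
     contains it. *)
  have [->//|ltca] := phi_class_le Pc Pa ca.
  by apply: Iinit Ia ltca; exists c.
have [a Pa eA] := IQ _ IA; rewrite -eA in IA *.
exists a => //; split=> //; exists a => //; split=> //.
by rewrite gtr0_norm//; case: Pa.
Qed.

Lemma ring_of_segment_valuation_ring (I : set (set K)) :
  nonempty_initial_segments v I -> convex_valuation_rings v (ring_of_segment I).
Proof.
move=> hI; apply/convex_valuation_ringsP; split; first exact: ring_of_segment_convex.
have [_ [A]] := hI; rewrite -[X in X A](ring_of_segmentK hI) => -[a Ra _].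
by exists a.
Qed.

(** * Principal rings and last elements *)

Lemma convex_closure_pow a : PK a ->
  convex_subring [set x | exists n, `|x| <= a ^+ (2 ^ n)].
Proof.
move=> Pa.
have bound (x y : K) : (exists n, `|x| <= a ^+ (2 ^ n)) ->
    (exists n, `|y| <= a ^+ (2 ^ n)) ->
    exists n, `|x| <= a ^+ (2 ^ n) /\ `|y| <= a ^+ (2 ^ n).
  move=> [n xa] [m ya]; exists (maxn n m); split; [move: xa|move: ya];
    by apply: (pow_bound_leq Pa); rewrite ?leq_maxl ?leq_maxr.
split; first split=> [|x y|x y]; rewrite ?inE /=.
- by exists 0%N; rewrite normr1 expn0 expr1; have := PK_gt2 Pa; lra.
(* Passing to [n.+1] squares the common bound, which exceeds 2 and so dominates the sum of the two
   absolute values. *)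
- move=> hx /(bound _ _ hx)[n [xa ya]]; exists n.+1.
  have := PK_gt2 (PK_le Pa (PK_le_pow n Pa)); have := ler_normB x y.
  rewrite expnSr exprM expr2; nra.
- move=> hx /(bound _ _ hx)[n [xa ya]]; exists n.+1.
  by rewrite expnSr exprM expr2 normrM ler_pM.
- move=> x y z hx /(bound _ _ hx)[n [xa ya]] /andP[xy yz]; exists n.
  by move: xa ya; rewrite !ler_norml; lra.
Qed.

Lemma principal_has_last R : convex_valuation_rings v R ->
  (exists2 a, PK a & generated_by R a) <-> has_last (segment_of_ring R).
Proof.
move=> hR; have /convex_valuation_ringsP[cR _] := hR; split.
  move=> [a Pa [_ Ra minR]]; exists (phi_class a); first exact/segment_of_ringP.
  move=> _ [b [Rb Pb] <-].
  (* Minimality against the ring of elements bounded by powers of [a] yields [b <= a ^+ (2 ^ n)], so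
     the class of [b] cannot lie above that of [a]. *)
  have [|n] := minR _ (convex_closure_pow Pa) _ _ Rb.
    by exists 0%N; rewrite expn0 expr1 gtr0_norm//; case: Pa.
  rewrite gtr0_norm; last by case: Pb.
  move=> ba; have [|ab] := phi_ltPn Pb Pa; [by right|left].
  by apply: phi_class_eq => //; apply/sim_phiP => //; split=> //; exists n.
(* Any representative of the last class generates: a convex [S] containing it contains all elements
   of that class and of the lower ones. *)
move=> [_ [a [Ra Pa] <-] last_a]; exists a => //; split=> // S cS Sa.
apply/segment_of_ring_sub => // _ [b [Rb Pb] <-].
have Sa' : segment_of_ring S (phi_class a) by apply/segment_of_ringP.
have [->//|ba] : phi_class b = phi_class a \/ phi_lt (phi_class b) (phi_class a).
  by apply: last_a; exists b.
apply/segment_of_ringP => //; apply: (convex_subring_le cS Sa).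
rewrite gtr0_norm; last by case: Pb.
by apply: ltW; apply: ba; exact: phi_class_refl.
Qed.

Lemma segment_of_ring_inj : set_inj (convex_valuation_rings v) segment_of_ring.
Proof.
move=> R S; rewrite !inE => /convex_valuation_ringsP[cR _].
move=> /convex_valuation_ringsP[cS _] e.
by apply/seteqP; split; apply/segment_of_ring_sub => //; rewrite e.
Qed.

End NaturalValuation.

Theorem theorem3p2 (K : realFieldType) (v : valuation K) :
  ~ Num.archimedean_axiom K -> natural_valuation v ->
  inclusion_isomorphic (convex_valuation_rings v) (nonempty_initial_segments v) /\
  inclusion_isomorphic (principal_valuation_rings v) (initial_segments_with_last v).
Proof.
move=> _ hv; have initial := segment_of_ring_initial hv.
have inj := segment_of_ring_inj hv.
have mono R S : convex_valuation_rings v R -> convex_valuation_rings v S ->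
    (R `<=` S <-> segment_of_ring v R `<=` segment_of_ring v S).
  move=> /(convex_valuation_ringsP hv)[cR _] /(convex_valuation_ringsP hv)[cS _].
  by apply: iff_sym; exact: segment_of_ring_sub.
(* One map serves both isomorphisms, the second being its restriction; [ring_of_segment] supplies
   the preimages. *)
split; exists (segment_of_ring v).
- split=> // I hI; exists (ring_of_segment v I); last exact: ring_of_segmentK.
  exact: ring_of_segment_valuation_ring.
- by move=> R S; exact: mono.
- split.
  + move=> R [hR pR]; split; first exact: initial.
    exact/(principal_has_last hv hR).
  + by move=> R S; rewrite !inE => -[hR _] [hS _]; apply: inj; rewrite inE.
  + move=> I [hI lI]; exists (ring_of_segment v I); last exact: ring_of_segmentK.
    have hR := ring_of_segment_valuation_ring hv hI.
    by split=> //; apply/(principal_has_last hv hR); rewrite ring_of_segmentK.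
- by move=> R S [hR _] [hS _]; exact: mono.
Qed.
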